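(* For every integer $j\ge 1$ and all $x$, \[ T_{j}(x)=j\sum_{m=0}^{\left\lfloor j/2\right\rfloor}(-1)^m\binom{j-m}{j-2m}\frac{2^{j-2m-1}}{j-m}\;{}_{2}F_{1}\!\left(\begin{matrix}-m,\ j-m\\ j-2m+2\end{matrix}\,\Big|\,-4\right)F_{j-2m+1}(x). \]
   Context: The Fibonacci polynomials are defined by $F_0(x)=0$, $F_1(x)=1$, $F_{n+2}(x)=xF_{n+1}(x)+F_n(x)$ for $n\ge 0$. $T_n(x)$ denotes the Chebyshev polynomial of the first kind, $T_n(\cos\theta)=\cos(n\theta)$ (equivalently $T_0=1$, $T_1=x$, $T_n=2xT_{n-1}-T_{n-2}$). For a nonnegative integer $m$, the terminating hypergeometric series is ${}_2F_1\!\left(\begin{smallmatrix}-m,\ b\\ c\end{smallmatrix}\big|z\right)=\sum_{k=0}^{m}\frac{(-m)_k(b)_k}{(c)_k\,k!}z^k$, where $(a)_k=a(a+1)\cdots(a+k-1)$ is the Pochhammer symbol. *)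

(* Defs.v *)
From mathcomp Require Export all_boot all_order all_algebra.
Set Implicit Arguments.
Unset Strict Implicit.
Unset Printing Implicit Defensive.
Import GRing.Theory Num.Theory.
Local Open Scope ring_scope.

Fixpoint fib_poly (R : comNzRingType) (n : nat) : {poly R} :=
  match n with
  | 0%N => 0
  | n1.+1 =>
      match n1 with
      | 0%N => 1
      | n2.+1 => 'X * fib_poly R n1 + fib_poly R n2
      end
  end.

Fixpoint chebyshevT (R : comNzRingType) (n : nat) : {poly R} :=
  match n with
  | 0%N => 1
  | n1.+1 =>
      match n1 with
      | 0%N => 'X
      | n2.+1 => 2%:R * 'X * chebyshevT R n1 - chebyshevT R n2
      end
  end.

Definition pochhammer (R : comNzRingType) (a : R) (k : nat) : R :=
  \prod_(i < k) (a + i%:R).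

(* The first upper parameter of the series is - m. *)
Definition hyp2F1_terminating (R : fieldType) (m : nat) (b c z : R) : R :=
  \sum_(0 <= k < m.+1)
    pochhammer (- m%:R) k * pochhammer b k / (pochhammer c k * k`!%:R) * z ^+ k.

(* Main.v *)
Require Import Defs.
From mathcomp Require Import all_boot all_order all_algebra.
From mathcomp Require Import zify ring.
Import GRing.Theory Num.Theory.
Local Open Scope ring_scope.

(** Write [T_j = \sum_(s + 2 m = j) D(s, m) F_(s+1)].  Since
    [x F_n = F_(n+1) - F_(n-1)] and [F_0 = 0], the recurrence of [T] amounts to
    [D(s, m) = 2 D(s-1, m) - 2 D(s+1, m-1) - D(s, m-1)] with [D(-1, m) = 0].
    Expanding [T_j] in powers of [x] and then the powers in Fibonacci
    polynomials shows that
    [D(s, m) = (-1)^m 2^(s-1) \sum_(k <= m) A(s + 2k, m - k) 4^k B(s, k)],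
    where [A(n, r) = (n + 2r) / (n + r) 'C(n + r, r)] and
    [B(s, k) = (s + 1) / (s + k + 1) 'C(s + 2k, k)].  Both families satisfy
    Pascal-like recurrences, which yield the recurrence of [D]; termwise, the
    sum is the hypergeometric series. *)

(* [lucas_coef r n] is A(n, r), with A(0, 0) = 2, and [ballot_coef k s] is
   B(s, k): the structurally decreasing index comes first. *)
Fixpoint lucas_coef (r n : nat) : nat :=
  match r with
  | 0%N => if n is 0%N then 2%N else 1%N
  | r1.+1 =>
      (fix row (n : nat) : nat :=
         match n with
         | 0%N => 2%N
         | n1.+1 => (row n1 + lucas_coef r1 n1.+1)%N
         end) n
  end.

Fixpoint ballot_coef (k s : nat) : nat :=
  match k with
  | 0%N => 1%N
  | k1.+1 =>
      (fix row (s : nat) : nat :=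
         match s with
         | 0%N => ballot_coef k1 1
         | s1.+1 => (row s1 + ballot_coef k1 s1.+2)%N
         end) s
  end.

(** * Recurrences and factorial forms of [A] and [B] *)

Lemma lucas_coefSS r n :
  lucas_coef r.+1 n.+1 = (lucas_coef r.+1 n + lucas_coef r n.+1)%N.
Proof. by []. Qed.

Lemma ballot_coefSS k s :
  ballot_coef k.+1 s.+1 = (ballot_coef k.+1 s + ballot_coef k s.+2)%N.
Proof. by []. Qed.

(** Closed form of [A(n, r)] with denominators cleared; naming [p = n + r - 1] excludes the
    exceptional [A(0, 0)]. *)
Lemma lucas_coef_fact r n p : (n + r = p.+1)%N ->
  (lucas_coef r n * (n`! * r`!) = (n + 2 * r) * p`!)%N.
Proof.
elim: r n p => [|r IHr] n p.
  by rewrite addn0 => ->; rewrite /= fact0 factS; ring.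
elim: n p => [|n IHn] p.
  by rewrite add0n => -[<-]; rewrite /= fact0 factS; ring.
case: p => [|p] e; first by lia.
have /IHn : (n + r.+1 = p.+1)%N by lia.
have /IHr : (n.+1 + r = p.+1)%N by lia.
have ->: p = (n + r)%N by lia.
rewrite lucas_coefSS !factS => IH1 IH2.
transitivity (n.+1 * (lucas_coef r.+1 n * (n`! * (r.+1 * r`!)))
  + r.+1 * (lucas_coef r n.+1 * (n.+1 * n`! * r`!)))%N; first by ring.
by rewrite IH1 IH2; ring.
Qed.

Lemma ballot_coef_fact k s :
  (ballot_coef k s * (k`! * (s + k).+1`!) = s.+1 * (s + 2 * k)`!)%N.
Proof.
elim: k s => [|k IHk] s.
  by rewrite [ballot_coef 0 s]/= muln0 !addn0 factS fact0; ring.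
elim: s => [|s IHs].
  (* At [s = 0] the recurrence reads [B(0, k+1) = B(1, k)], that is, [B(-1, k+1) = 0]. *)
  have := IHk 1%N; rewrite [ballot_coef k.+1 0]/=.
  have ->: (0 + 2 * k.+1 = (1 + 2 * k).+1)%N by lia.
  have ->: (0 + k.+1 = 1 + k)%N by lia.
  rewrite (factS (1 + 2 * k)) (factS k) => IH.
  transitivity (k.+1 * (ballot_coef k 1 * (k`! * (1 + k).+1`!)))%N.
    by ring.
  by rewrite IH; ring.
move: (IHk s.+2) IHs; rewrite ballot_coefSS.
have ->: (s.+1 + 2 * k.+1 = (s + 2 * k).+3)%N by lia.
have ->: (s + 2 * k.+1 = (s + 2 * k).+2)%N by lia.
have ->: (s.+2 + 2 * k = (s + 2 * k).+2)%N by lia.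
have ->: (s.+1 + k.+1 = (s + k).+2)%N by lia.
have ->: (s + k.+1 = (s + k).+1)%N by lia.
have ->: (s.+2 + k = (s + k).+2)%N by lia.
rewrite (factS (s + 2 * k).+2) (factS k) (factS (s + k).+2) => IH1 IH2.
transitivity ((s + k).+3 * (ballot_coef k.+1 s * (k.+1 * k`! * (s + k).+2`!))
  + k.+1 * (ballot_coef k s.+2 * (k`! * ((s + k).+3 * (s + k).+2`!))))%N.
  by ring.
by rewrite IH1 IH2; ring.
Qed.

(** * The convolution of [A] and [B], and its recurrences *)

(** The sequence [c] stands for [B(s, _)]. Keeping it free lets the [s] in [A] and the [s] in [B]
    move independently. *)
Definition lucas_conv (c : nat -> nat) (n m : nat) : nat :=
  (\sum_(k < m.+1) lucas_coef (m - k) (n + 2 * k) * 4 ^ k * c k)%N.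

Lemma lucas_convS c n m : lucas_conv c n m.+1 =
  (lucas_coef m.+1 n * c 0 + 4 * lucas_conv (c \o succn) n.+2 m)%N.
Proof.
rewrite /lucas_conv big_ord_recl subn0 muln0 addn0 expn0 muln1; congr (_ + _)%N.
rewrite big_distrr; apply: eq_bigr => k _.
rewrite lift0 subSS expnS.
have -> : (n + 2 * k.+1 = n.+2 + 2 * k)%N by lia.
by rewrite -!mulnA mulnCA.
Qed.

(** Pascal recurrence of [A] for [k <= m]. In the term [k = m + 1] both sides contain [A(_, 0) = 1],
    its argument being positive. *)
Lemma lucas_convSS c n m : lucas_conv c n.+1 m.+1 =
  (lucas_conv c n m.+1 + lucas_conv c n.+1 m)%N.
Proof.
rewrite /lucas_conv big_ord_recr [in RHS]big_ord_recr /= !subnn.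
rewrite [RHS]addnAC -big_split /=; congr (_ + _)%N.
  apply: eq_bigr => k _; rewrite subSn -1?ltnS // addSn lucas_coefSS.
  by rewrite !mulnDl.
by rewrite mulnS addnS.
Qed.

Definition chebfib_coef (s m : nat) : nat := lucas_conv (ballot_coef^~ s) s m.

Lemma chebfib_coef0 s : chebfib_coef s 0 = if s is 0%N then 2%N else 1%N.
Proof. by rewrite /chebfib_coef /lucas_conv big_ord1 addn0; case: s. Qed.

(** Boundary case [D(-1, _) = 0]: since [B(0, k+1) = B(1, k)], the terms [k > 0] form a convolution
    with [B(1, _)], to which the recurrence of [A] applies. *)
Lemma chebfib_coef0S m :
  chebfib_coef 0 m.+1 = (4 * chebfib_coef 1 m + chebfib_coef 0 m)%N.
Proof.
rewrite /chebfib_coef lucas_convS.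
have -> : (ballot_coef^~ 0%N) \o succn = ballot_coef^~ 1%N by [].
case: m => [|m]; first by rewrite /lucas_conv !big_ord1.
rewrite lucas_convSS [in RHS](lucas_convS _ 0) /=.
have -> : lucas_conv (ballot_coef^~ 0%N \o succn) 2 m =
          lucas_conv (ballot_coef^~ 1%N) 2 m by [].
by ring.
Qed.

(** The recurrence of [A] at fixed [B(s+1, _)] splits off the last summand; that of [B] then splits
    the rest. *)
Lemma chebfib_coefSS s m :
  chebfib_coef s.+1 m.+1 =
  (chebfib_coef s m.+1 + 4 * chebfib_coef s.+2 m + chebfib_coef s.+1 m)%N.
Proof.
rewrite /chebfib_coef lucas_convSS; congr (_ + _)%N.
rewrite !lucas_convS -addnA -mulnDr; congr (_ + 4 * _)%N.
by rewrite -big_split; apply: eq_bigr => k _ /=; rewrite -mulnDr.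
Qed.

(** * Sums over [s + 2 m = j] *)

Section AntidiagonalSum.
Variable R : numFieldType.
Implicit Types f g : nat -> nat -> R.

Definition antidiag f (j : nat) : R :=
  \sum_(0 <= m < (j %/ 2).+1) f (j - 2 * m)%N m.

Lemma antidiag0 f : antidiag f 0 = f 0%N 0%N.
Proof. by rewrite /antidiag big_nat1. Qed.

Lemma antidiag1 f : antidiag f 1 = f 1%N 0%N.
Proof. by rewrite /antidiag big_nat1. Qed.

Lemma antidiagSS f j :
  antidiag f j.+2 = f j.+2 0%N + antidiag (fun s m => f s m.+1) j.
Proof.
rewrite /antidiag; have ->: (j.+2 %/ 2 = (j %/ 2).+1)%N by lia.
rewrite big_nat_recl // muln0 subn0; congr (_ + _).
by apply: eq_bigr => m _; congr (f _ _); lia.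
Qed.

Lemma eq_antidiag f g j : (forall s m, (s + 2 * m = j)%N -> f s m = g s m) ->
  antidiag f j = antidiag g j.
Proof.
move=> fg; rewrite /antidiag !big_nat; apply: eq_bigr => m hm.
by apply: fg; lia.
Qed.

Lemma antidiagD f g j :
  antidiag (fun s m => f s m + g s m) j = antidiag f j + antidiag g j.
Proof. exact: big_split. Qed.

Lemma antidiagZ c f j : antidiag (fun s m => c * f s m) j = c * antidiag f j.
Proof. by rewrite /antidiag mulr_sumr. Qed.

Lemma antidiag_shift f j : (forall m, f 0%N m = 0) ->
  antidiag f j.+1 = antidiag (fun s m => f s.+1 m) j.
Proof.
elim/ltn_ind: j f => -[|[|j]] IH f f0.
- by rewrite antidiag1 antidiag0.
- by rewrite antidiagSS antidiag0 f0 addr0 antidiag1.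
- by rewrite !antidiagSS IH.
Qed.

(** * Chebyshev polynomials in terms of Fibonacci polynomials *)

Lemma chebyshevT_fib (x : R) j :
  (chebyshevT R j).[x] =
  antidiag (fun s m => (-1) ^+ m * (2 ^+ s / 2) * (chebfib_coef s m)%:R
                       * (fib_poly R s.+1).[x]) j.
Proof.
have n2 : (2 : R) != 0 by rewrite pnatr_eq0.
have fibSS n : (fib_poly R n.+2).[x] =
    x * (fib_poly R n.+1).[x] + (fib_poly R n).[x].
  by rewrite [fib_poly R n.+2]/= !hornerE.
elim/ltn_ind: j => -[|[|j]] IH.
(* [A(0, 0) = 2] compensates the factor [2^(-1)] at [s = 0]. *)
- by rewrite antidiag0 chebfib_coef0 /= !hornerE; field.
- by rewrite antidiag1 chebfib_coef0 /= !hornerE; field.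
have ->: (chebyshevT R j.+2).[x] =
    2 * x * (chebyshevT R j.+1).[x] + (-1) * (chebyshevT R j).[x].
  by rewrite mulN1r [chebyshevT R j.+2]/= !hornerE.
rewrite !IH // -!antidiagZ.
pose D s m : R := (-1) ^+ m * (2 ^+ s / 2) * (chebfib_coef s m)%:R.
pose G s m : R := if s is s1.+1 then 2 * D s1 m else 0.
(* By [x F_(s+1) = F_(s+2) - F_s], the term [2 x T_(j+1)] gives two sums: [s] is shifted up in the
   first, where [G] encodes [D(-1, m) = 0], and down in the second, where [F_0 = 0]. *)
transitivity
  (antidiag (fun s m => G s m * (fib_poly R s.+1).[x]) j.+2
   + antidiag (fun s m => - 2 * D s.+1 m * (fib_poly R s.+1).[x]) j
   + antidiag (fun s m => - 1 * (D s m * (fib_poly R s.+1).[x])) j).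
  congr (_ + _).
  rewrite [X in _ = X + _]antidiag_shift; last by move=> m; rewrite /G mul0r.
  rewrite -(@antidiag_shift (fun s m => - 2 * D s m * (fib_poly R s).[x])).
    rewrite -antidiagD; apply: eq_antidiag => s m _.
    by rewrite fibSS /G /D; ring.
  by move=> m; rewrite /= hornerC mulr0.
rewrite !antidiagSS -!addrA -!antidiagD; congr (_ + _).
  by rewrite /G /D !chebfib_coef0; case: (j) => [|?]; rewrite !exprS; field.
apply: eq_antidiag => s m _; rewrite /G /D; case: s => [|s].
  by rewrite chebfib_coef0S (natrD _ (4 * _)) (natrM _ 4) !exprS; field.
rewrite chebfib_coefSS (natrD _ (_ + 4 * _)) (natrD _ _ (4 * _)) (natrM _ 4).
by rewrite !exprS; field.
Qed.

(** * Terms of the hypergeometric series *)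

Lemma pochhammer_natS n k :
  pochhammer (n.+1%:R : R) k * n`!%:R = (n + k)`!%:R.
Proof.
elim: k => [|k IHk]; first by rewrite /pochhammer big_ord0 mul1r addn0.
rewrite /pochhammer big_ord_recr /= mulrAC -/(pochhammer _ _) IHk.
by rewrite addnS factS mulnC natrM -natrD addSn.
Qed.

Lemma pochhammer_oppn r k :
  pochhammer (- (r + k)%:R : R) k * r`!%:R = (-1) ^+ k * (r + k)`!%:R.
Proof.
elim: k r => [|k IHk] r.
  by rewrite /pochhammer big_ord0 expr0 !mul1r addn0.
rewrite /pochhammer big_ord_recr /= -/(pochhammer _ _) mulrAC.
(* Raising [r] keeps the number [r + k + 1] under the Pochhammer symbol fixed. *)
have := IHk r.+1; rewrite addSnnS factS natrM => IH.
have ->: - (r + k.+1)%:R + k%:R = - r.+1%:R :> R.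
  by rewrite !natrD -[in RHS]addn1 -[in LHS](addn1 k) !natrD; ring.
by rewrite exprS mulN1r mulNr -IH; ring.
Qed.

(** The prefactor is [A(s, m)]. In factorials everything cancels, the signs of [(-m)_k] and [(-4)^k]
    included. *)
Lemma hyp2F1_term_lucas_ballot s m k p : (s + m = p.+1)%N -> (k <= m)%N ->
  (s + 2 * m)%:R * 'C(s + m, s)%:R / (s + m)%:R
  * (pochhammer (- m%:R) k * pochhammer (s + m)%:R k
     / (pochhammer (s%:R + 2) k * k`!%:R) * (- 4) ^+ k)
  = (lucas_coef (m - k) (s + 2 * k) * 4 ^ k * ballot_coef k s)%:R :> R.
Proof.
move=> hp km.
have factn0 n : n`!%:R != 0 :> R by rewrite pnatr_eq0 -lt0n fact_gt0.
set r := (m - k)%N.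
have hm : m = (r + k)%N by rewrite subnK.
have e1 : (lucas_coef r (s + 2 * k))%:R =
    (s + 2 * m)%:R * (p + k)`!%:R / ((s + 2 * k)`!%:R * r`!%:R) :> R.
  have := @lucas_coef_fact r (s + 2 * k) (p + k).
  have ->: (s + 2 * k + 2 * r = s + 2 * m)%N by lia.
  move=> h; apply: (canRL (mulfK _)); first by rewrite mulf_neq0.
  by rewrite -!natrM h //; lia.
have e2 : (ballot_coef k s)%:R =
    s.+1%:R * (s + 2 * k)`!%:R / (k`!%:R * (s + k).+1`!%:R) :> R.
  apply: (canRL (mulfK _)); first by rewrite mulf_neq0.
  by rewrite -!natrM ballot_coef_fact.
have e3 : pochhammer (- m%:R : R) k = (-1) ^+ k * m`!%:R / r`!%:R.
  by apply: (canRL (mulfK _)); rewrite // hm pochhammer_oppn.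
have e4 : pochhammer ((s + m)%:R : R) k = (p + k)`!%:R / p`!%:R.
  by apply: (canRL (mulfK _)); rewrite // hp pochhammer_natS.
have e5 : pochhammer (s%:R + 2 : R) k = (s + k).+1`!%:R / s.+1`!%:R.
  apply: (canRL (mulfK _)) => //; rewrite -natrD addn2.
  by rewrite pochhammer_natS.
have e6 : 'C(s + m, s)%:R = (s + m)%:R * p`!%:R / (s`!%:R * m`!%:R) :> R.
  apply: (canRL (mulfK _)); first by rewrite mulf_neq0.
  have := @bin_fact (s + m) s (leq_addr _ _).
  by rewrite addKn -!natrM => ->; rewrite hp factS.
have e7 : (- 4 : R) ^+ k = (-1) ^+ k * 4 ^+ k by rewrite -exprMn mulN1r.
have e8 : (-1) ^+ k * (-1) ^+ k = 1 :> R by rewrite -exprMn mulrNN mulr1 expr1n.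
rewrite !natrM natrX e1 e2 e3 e4 e5 e6 e7 (factS s) natrM.
have sm0 : (s + m)%:R != 0 :> R by rewrite hp pnatr_eq0.
have s0 : s.+1%:R != 0 :> R by rewrite pnatr_eq0.
rewrite -[RHS]mul1r -[X in _ = X * _]e8; field.
by rewrite !factn0 nat1r -natrD s0 sm0.
Qed.

End AntidiagonalSum.

Theorem theorem1 (R : numFieldType) (j : nat) (hj : (1 <= j)%N) (x : R) :
  (chebyshevT R j).[x] =
  j%:R * \sum_(0 <= m < (j %/ 2).+1)
    (-1) ^+ m * 'C(j - m, j - 2 * m)%:R
    * ((2%:R : R) ^ (j%:Z - 2 * m%:Z - 1) / (j%:R - m%:R))
    * hyp2F1_terminating m (j%:R - m%:R) (j%:R - 2 * m%:R + 2) (- 4)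
    * (fib_poly R (j - 2 * m + 1)).[x].
Proof.
rewrite chebyshevT_fib /antidiag mulr_sumr !big_nat; apply: eq_bigr => m hm.
(* Writing [j = s + 2 m] removes all truncated subtractions. *)
have [s ej] : exists s, j = (s + 2 * m)%N by exists (j - 2 * m)%N; lia.
have -> : (j - 2 * m = s)%N by lia.
have -> : (j - m = s + m)%N by lia.
have -> : j%:R - m%:R = (s + m)%:R :> R by rewrite ej; ring.
have -> : j%:R - 2 * m%:R = s%:R :> R by rewrite ej; ring.
have -> : j%:Z - 2 * m%:Z - 1 = s%:Z - 1 by lia.
have -> : (2%:R : R) ^ (s%:Z - 1) = 2 ^+ s / 2.
  by rewrite expfzDr ?pnatr_eq0.
rewrite addn1.
(* [j >= 1] makes the denominator [s + m] nonzero. *)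
case ep : (s + m)%N => [|p]; first by lia.
rewrite -ep /hyp2F1_terminating /chebfib_coef /lucas_conv natr_sum big_mkord.
set F := _.[x]; set t := (X in _ = _ * (_ * X * F)).
have -> : \sum_(i < m.+1)
    (lucas_coef (m - i) (s + 2 * i) * 4 ^ i * ballot_coef i s)%:R =
    j%:R * 'C(s + m, s)%:R / (s + m)%:R * t.
  rewrite /t mulr_sumr; apply: eq_bigr => k _.
  by rewrite -(@hyp2F1_term_lucas_ballot _ _ _ _ _ ep) ?leq_ord // -ej.
by ring.
Qed.
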